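(* Let $a$ be an odd integer greater than $2$. Then $G_{2,a}=4a-2$.
   Context: For coprime positive integers $a_1,a_2$, $G_{a_1,a_2}$ denotes the least integer such that every integer $n>G_{a_1,a_2}$ can be written as $n=a_1x_1+a_2x_2$ with $x_1,x_2\in\mathbb{Z}_{\ge0}$ and $\gcd(x_1,x_2)=1$. *)

(* Defs.v *)
From Stdlib Require Import ZArith Lia.
Open Scope Z_scope.

Definition primitively_representable (a1 a2 n : Z) : Prop :=
  exists x1 x2 : Z,
    0 <= x1 /\ 0 <= x2 /\ Z.gcd x1 x2 = 1 /\ n = a1 * x1 + a2 * x2.

Definition all_above_representable (a1 a2 g : Z) : Prop :=
  forall n : Z, g < n -> primitively_representable a1 a2 n.

(* [is_G a1 a2 g] says "G_{a1,a2} exists and equals g"; it is a relation so that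
   no junk value is needed when a1, a2 are not coprime positive integers. *)
Definition is_G (a1 a2 g : Z) : Prop :=
  all_above_representable a1 a2 g /\
  forall g' : Z, all_above_representable a1 a2 g' -> g <= g'.

Lemma is_G_unique (a1 a2 g h : Z) : is_G a1 a2 g -> is_G a1 a2 h -> g = h.
Proof.
  intros [Hg Lg] [Hh Lh]. specialize (Lg h Hh). specialize (Lh g Hg). lia.
Qed.

(* Main.v *)
Require Import Defs.
From Stdlib Require Import ZArith Lia.
Open Scope Z_scope.

(** Above [4a - 2], an odd [n] takes [x2 = 1]. An even [n] takes whichever of
    [x2 = 2] and [x2 = 4] makes [x1 = n/2 - a * x2 / 2] odd, hence coprime to
    the power of two [x2]. The value [4a - 2] itself only admits
    [x2 = 0] or [x2 = 2], where [gcd x1 x2] is [2a - 1] or [2]. *)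

Lemma gcd_odd_2 (k : Z) : Z.gcd (2 * k + 1) 2 = 1.
Proof. apply Z.bezout_1_gcd. exists 1, (- k). lia. Qed.

Lemma gcd_odd_4 (k : Z) : Z.gcd (2 * k + 1) 4 = 1.
(* The Bezout coefficients come from [(2 * k + 1)^2 = 4 * k * (k + 1) + 1]. *)
Proof. apply Z.bezout_1_gcd. exists (2 * k + 1), (- (k * (k + 1))). lia. Qed.

Lemma representable_above (a : Z) (a_odd : Z.Odd a) (a_gt2 : 2 < a) :
  all_above_representable 2 a (4 * a - 2).
Proof.
  intros n Hn. destruct a_odd as [b Hb].
  destruct (Z.Even_or_Odd n) as [[m Hm] | [m Hm]].
  - destruct (Z.Even_or_Odd m) as [[k Hk] | [k Hk]].
    + exists (2 * (k - b - 1) + 1), 2. repeat split; try lia. apply gcd_odd_2.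
    (* Here [n] and [4 * a - 2] are both 2 mod 4, so [n >= 4 * a + 2], which gives [k >= a] and
       [x1 > 0]. *)
    + exists (2 * (k - a) + 1), 4. repeat split; try lia. apply gcd_odd_4.
  - exists (m - b), 1. repeat split; try lia. apply Z.gcd_1_r.
Qed.

Lemma not_representable_4a_sub_2 (a : Z) (a_odd : Z.Odd a) (a_gt2 : 2 < a) :
  ~ primitively_representable 2 a (4 * a - 2).
Proof.
  intros (x & y & Hx & Hy & Hgcd & Hn). destruct a_odd as [b Hb].
  assert (y < 4) by nia.
  (* Odd [y] is ruled out by parity: [a * y] must be even while [a] is odd. *)
  assert (y = 0 \/ y = 1 \/ y = 2 \/ y = 3) as [-> | [-> | [-> | ->]]] by lia;
    try lia.
  - rewrite Z.gcd_0_r in Hgcd. lia.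
  - assert (H2 : (2 | Z.gcd x 2)).
    (* With [y = 2], [x = a - 1 = 2 * b]. *)
    { apply Z.gcd_greatest; [exists b; lia | apply Z.divide_refl]. }
    rewrite Hgcd in H2. destruct H2 as [c Hc]. lia.
Qed.

Theorem theorem6 (a : Z) (a_odd : Z.Odd a) (a_gt2 : 2 < a) :
  is_G 2 a (4 * a - 2).
Proof.
  split.
  - now apply representable_above.
  (* A smaller bound [g'] would make [4 * a - 2] itself representable. *)
  - intros g' Hg'. destruct (Z.le_gt_cases (4 * a - 2) g') as [|Hlt]; [assumption|].
    now destruct (not_representable_4a_sub_2 a a_odd a_gt2 (Hg' _ Hlt)).
Qed.
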